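(* Assume that for every $\lambda\in\mathbb{R}^m$ the point $\bar z(\lambda)\in Z$ satisfies $$\min_{z\in Z}\langle \nabla\mathcal{L}_\rho(\bar z(\lambda),\lambda),\, z-\bar z(\lambda)\rangle \ge -\left(1+\sqrt{2L_{\mathrm p}}\,R_{\mathrm p}\right)\varepsilon_{\mathrm{in}} .$$ Let $\theta_0=1$, $\theta_{k+1}=\frac12\left(1+\sqrt{4\theta_k^2+1}\right)$, $S_k=\sum_{j=0}^k\theta_j$, $a_{k+1}=S_{k+1}^{-1}\theta_{k+1}$, and let $(\lambda_k)_{k\ge0}$, $(\mu_k)_{k\ge0}$ be generated from $\lambda_0\in\mathbb{R}^m$ by $$\mu_k=\lambda_k+L_{\mathrm d}^{-1}\nabla\bar d_\rho(\lambda_k),\qquad \lambda_{k+1}=(1-a_{k+1})\mu_k+a_{k+1}\Big[\lambda_0+L_{\mathrm d}^{-1}\sum_{i=0}^k\theta_i\nabla\bar d_\rho(\lambda_i)\Big].$$ Let $\bar z_j=\bar z(\lambda_j)$ and $\hat z_k=S_k^{-1}\sum_{j=0}^k\theta_j\bar z_j$. Then for every $k\ge0$ $$\|A\hat z_k-b\|\le v(k,\varepsilon_{\mathrm{in}}),\qquad v(k,\varepsilon_{\mathrm{in}}):=\frac{8L_{\mathrm d}R_{\mathrm d}}{(k+1)(k+2)}+4\sqrt{\frac{2L_{\mathrm d}(k+3)\left(1+\sqrt{2L_{\mathrm p}}\,R_{\mathrm p}\right)\varepsilon_{\mathrm{in}}}{3(k+1)(k+2)}},$$ where $R_{\mathrm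 d}=\|\lambda_0-\lambda^*\|$.
   Context: Setting: $f:\mathbb{R}^n\to\mathbb{R}$ is convex and differentiable, $A\in\mathbb{R}^{m\times n}$ has full row rank, $b\in\mathbb{R}^m$, $Z\subset\mathbb{R}^n$ is nonempty, compact and convex, $\rho>0$, $\varepsilon_{\mathrm{in}}>0$; $\|\cdot\|$ and $\langle\cdot,\cdot\rangle$ are the Euclidean norm and inner product. Primal problem: $f^*=\min\{f(z): Az=b,\ z\in Z\}$. Augmented Lagrangian: $\mathcal{L}_\rho(z,\lambda)=f(z)+\langle\lambda,Az-b\rangle+\frac\rho2\|Az-b\|^2$; $\nabla\mathcal{L}_\rho$ denotes its gradient in $z$, assumed Lipschitz continuous in $z$ on $\mathbb{R}^n$ with constant $L_{\mathrm p}>0$ for each $\lambda$. $R_{\mathrm p}=\max_{z,y\in Z}\|z-y\|$. Augmented dual function: $d_\rho(\lambda)=\min_{z\in Z}\mathcal{L}_\rho(z,\lambda)$. Slater's constraint qualification is assumed, so that $f^*=\max_{\lambda}\min_{z\in Z}\{f(z)+\langle\lambda,Az-b\rangle\}$; $\lambda^*$ denotes a maximizer of this dual problem (the ordinary dual and the problem $\max_\lambda d_\rho(\lambda)$ have the same optimal value and the same optimal solutions). $L_{\mathrm d}=1/\rho$. Inexact dual information: for each $\lambda$ an approximate minimizer $\bar z(\lambda)\in Z$ of $\mathcal{L}_\rho(\cdot,\lambda)$ over $Z$ is fixed, and $\nabla\bar d_\rho(\lambda):=A\bar z(\lambda)-b$ (a notation, not necessarily a gradient). *)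

(* Defs.v *)
From HB Require Import structures.
From mathcomp Require Import all_boot all_order all_algebra.
From mathcomp Require Import all_classical all_reals all_analysis.

Set Implicit Arguments.
Unset Strict Implicit.
Unset Printing Implicit Defensive.

Import Order.TTheory GRing.Theory Num.Theory.
Import numFieldNormedType.Exports.

Local Open Scope classical_set_scope.
Local Open Scope ring_scope.

Definition dotv (R : realType) (n : nat) (x y : 'cV[R]_n) : R :=
  \sum_(i < n) x i ord0 * y i ord0.

(* The library norm `|x| on matrices is the sup norm; the Euclidean norm induces
   the same topology, so that [compact] and [differentiable] are unaffected. *)
Definition enorm (R : realType) (n : nat) (x : 'cV[R]_n) : R :=
  Num.sqrt (dotv x x).

Definition grad (R : realType) (n : nat) (g : 'cV[R]_n -> R) (z : 'cV[R]_n) :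
    'cV[R]_n :=
  \col_(i < n) 'D_(delta_mx i ord0) g z.

(* [inf] and [sup] on reals are 0 on sets that are empty or unbounded; below, Z
   is compact and nonempty and g is continuous, so these extrema are attained. *)
Definition min_over (R : realType) (n : nat) (Z : set 'cV[R]_n)
    (g : 'cV[R]_n -> R) : R :=
  inf [set g z | z in Z].

Definition diameter (R : realType) (n : nat) (Z : set 'cV[R]_n) : R :=
  sup [set enorm (z - y) | z in Z & y in Z].

Definition affine_hull (R : realType) (n : nat) (Z : set 'cV[R]_n) :
    set 'cV[R]_n :=
  [set x | exists (k : nat) (c : 'I_k -> R) (p : 'I_k -> 'cV[R]_n),
     [/\ forall i, Z (p i), \sum_(i < k) c i = 1
       & x = \sum_(i < k) c i *: p i]].

Definition relint (R : realType) (n : nat) (Z : set 'cV[R]_n) : set 'cV[R]_n :=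
  [set z | Z z /\ exists2 e : R, 0 < e &
     forall x, affine_hull Z x -> enorm (x - z) < e -> Z x].

Definition slater (R : realType) (m n : nat) (A : 'M[R]_(m, n)) (b : 'cV[R]_m)
    (Z : set 'cV[R]_n) : Prop :=
  exists2 z, relint Z z & A *m z = b.

Definition lagr (R : realType) (m n : nat) (f : 'cV[R]_n -> R)
    (A : 'M[R]_(m, n)) (b : 'cV[R]_m) (l : 'cV[R]_m) (z : 'cV[R]_n) : R :=
  f z + dotv l (A *m z - b).

Definition aug_lagr (R : realType) (m n : nat) (f : 'cV[R]_n -> R)
    (A : 'M[R]_(m, n)) (b : 'cV[R]_m) (rho : R) (l : 'cV[R]_m) (z : 'cV[R]_n) :
    R :=
  f z + dotv l (A *m z - b) + rho / 2 * enorm (A *m z - b) ^+ 2.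

Definition dual (R : realType) (m n : nat) (f : 'cV[R]_n -> R)
    (A : 'M[R]_(m, n)) (b : 'cV[R]_m) (Z : set 'cV[R]_n) (l : 'cV[R]_m) : R :=
  min_over Z (lagr f A b l).

Definition dual_solution (R : realType) (m n : nat) (f : 'cV[R]_n -> R)
    (A : 'M[R]_(m, n)) (b : 'cV[R]_m) (Z : set 'cV[R]_n) (ls : 'cV[R]_m) :
    Prop :=
  forall l, dual f A b Z l <= dual f A b Z ls.

Fixpoint theta (R : realType) (k : nat) : R :=
  if k is k'.+1 then (1 + Num.sqrt (4 * theta R k' ^+ 2 + 1)) / 2 else 1.

Definition Ssum (R : realType) (k : nat) : R := \sum_(j < k.+1) theta R j.

Definition acoef (R : realType) (k : nat) : R := (Ssum R k)^-1 * theta R k.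

(* delta stands for (1 + sqrt (2 Lp) Rp) * eps_in *)
Definition feas_bound (R : realType) (Ld Rd delta : R) (k : nat) : R :=
  8 * Ld * Rd / ((k%:R + 1) * (k%:R + 2)) +
  4 * Num.sqrt (2 * Ld * (k%:R + 3) * delta / (3 * (k%:R + 1) * (k%:R + 2))).

(* Main.v *)
(** The proof rests on an inexact oracle. Write [w z = A z - b] and let [d_rho]
    be the augmented dual function. As
    [grad L_rho(z, l) = grad f z + A^T (l + rho w z)], convexity of [f] and a
    completed square in [w] turn the stationarity of [zbar y] up to [delta] into
      [0 <= L_rho(zbar y, l) - d_rho(l) <= |l - y|^2 / (2 rho) + delta]
    for all [y] and [l]; the middle term compares [d_rho] with the affine model
    [l |-> L_rho(zbar y, l)], whose slope is [w (zbar y)].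
    Let [c_k = lambda_0 + Ld^-1 sum_j theta_j w(zbar_j)] be the maximizer of the
    estimate [sum_j theta_j model_j(l) - Ld/2 |l - lambda_0|^2]. By induction,
    the value at [c_k] is at most [S_k d_rho(mu_k) + delta sum_j S_j]; comparing
    it with the value at a maximizer [l*] of [d_rho] gives
      [|c_k - l*|^2 <= |lambda_0 - l*|^2 + (2 / Ld) delta sum_j S_j].
    Finally [A zhat_k - b = (Ld / S_k) (c_k - lambda_0)], and [S_k] grows
    quadratically. *)

Require Import Defs.
From HB Require Import structures.
From mathcomp Require Import all_boot all_order all_algebra.
From mathcomp Require Import all_classical all_reals all_analysis.
From mathcomp Require Import ring lra.

Set Implicit Arguments.
Unset Strict Implicit.
Unset Printing Implicit Defensive.

Import Order.TTheory GRing.Theory Num.Theory.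
Import numFieldNormedType.Exports.

Local Open Scope classical_set_scope.
Local Open Scope ring_scope.

Section DotProduct.
Variables (R : realType) (n : nat).
Implicit Types (x y z : 'cV[R]_n) (a : R).

Lemma dotvE x y : dotv x y = (x^T *m y) ord0 ord0.
Proof. by rewrite mxE; apply: eq_bigr => i _; rewrite mxE. Qed.

Lemma dotvC x y : dotv x y = dotv y x.
Proof. by apply: eq_bigr => i _; rewrite mulrC. Qed.

Lemma dotv_is_bilinear :
  bilinear_for (GRing.Scale.Law.clone _ _ *%R _)
    (GRing.Scale.Law.clone _ _ *%R _) (@dotv R n).
Proof.
suff linear_dotvr x : linear_for *%R (@dotv R n x).
  by split=> [y a x z|//]; rewrite !(dotvC _ y) linear_dotvr.
by move=> a y z; rewrite !dotvE linearP !mxE.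
Qed.

HB.instance Definition _ :=
  bilinear_isBilinear.Build R 'cV[R]_n 'cV[R]_n R _ _ (@dotv R n)
    dotv_is_bilinear.

Definition dotv_linear := (linearDl (@dotv R n), linearDr (@dotv R n),
  linearNl (@dotv R n), linearNr (@dotv R n),
  linearZl_LR (@dotv R n), linearZr_LR (@dotv R n)).

Lemma dotv_ge0 x : 0 <= dotv x x.
Proof. by apply: sumr_ge0 => i _; rewrite -expr2 sqr_ge0. Qed.

Lemma dotv_eq0 x : (dotv x x == 0) = (x == 0).
Proof.
apply/eqP/eqP => [/eqP|->]; last by rewrite linear0l.
rewrite psumr_eq0 => [/allP x0|i _]; last by rewrite -expr2 sqr_ge0.
apply/colP => i; rewrite mxE; apply/eqP.
by have := x0 i (mem_index_enum i); rewrite mulf_eq0 orbb.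
Qed.

Lemma dotv_delta x i : dotv x (delta_mx i ord0) = x i ord0.
Proof.
rewrite /dotv (bigD1 i)//= big1 => [|j /negPf ji]; rewrite mxE ?ji ?mulr0//.
by rewrite !eqxx mulr1 addr0.
Qed.

Lemma sqr_enorm x : enorm x ^+ 2 = dotv x x.
Proof. by rewrite sqr_sqrtr ?dotv_ge0. Qed.

Lemma enorm_ge0 x : 0 <= enorm x.
Proof. exact: sqrtr_ge0. Qed.

Lemma enorm_distC x y : enorm (x - y) = enorm (y - x).
Proof. by rewrite /enorm -(opprB x) linearNl linearNr opprK. Qed.

Lemma enormZ a x : enorm (a *: x) = `|a| * enorm x.
Proof.
by rewrite /enorm !dotv_linear /= mulrA -expr2 sqrtrM ?sqr_ge0// sqrtr_sqr.
Qed.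

Lemma cauchy_schwarz_dotv x y : dotv x y <= enorm x * enorm y.
Proof.
have [->|y_neq0] := eqVneq y 0; first by rewrite linear0r mulr_ge0 ?enorm_ge0.
have yy_gt0 : 0 < dotv y y by rewrite lt0r dotv_eq0 y_neq0 dotv_ge0.
have sqr_le : dotv x y ^+ 2 <= dotv x x * dotv y y.
  rewrite -(ler_pM2l yy_gt0).
  have := dotv_ge0 (dotv y y *: x - dotv x y *: y).
  by rewrite !dotv_linear /= (dotvC y x); lra.
rewrite -sqrtrM ?dotv_ge0//; apply: le_trans (ler_wsqrtr sqr_le).
by rewrite sqrtr_sqr ler_norm.
Qed.

Lemma ler_enormD x y : enorm (x + y) <= enorm x + enorm y.
Proof.
rewrite -ler_sqr ?nnegrE ?addr_ge0 ?enorm_ge0// sqrrD !sqr_enorm.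
by have := cauchy_schwarz_dotv x y; rewrite !dotv_linear /= (dotvC y x); lra.
Qed.

End DotProduct.

Lemma dotv_mulmx (R : realType) (m n : nat) (A : 'M[R]_(m, n)) x y :
  dotv x (A *m y) = dotv (A^T *m x) y.
Proof. by rewrite !dotvE trmx_mul trmxK mulmxA. Qed.

Section Continuity.
Variable R : realType.

Lemma continuous_dotv (T : topologicalType) (n : nat) (F G : T -> 'cV[R]_n) :
  continuous F -> continuous G -> continuous (fun t => dotv (F t) (G t)).
Proof.
move=> F_cont G_cont; have coord i (H : T -> 'cV[R]_n) :
    continuous H -> continuous (fun t => H t i ord0).
  move=> H_cont t; apply: (cvg_comp H (fun M => M i ord0) (H_cont t)).
  exact: coord_continuous.
rewrite /dotv; apply: (continuous_big (@add_continuous R)) => i _ t.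
by apply: cvgM; exact: coord.
Qed.

Lemma linear_mx_continuous (m n : nat) (V : normedModType R)
  (phi : {linear 'M[R]_(m, n) -> V}) : continuous phi.
Proof.
have -> : phi =
    (fun M => \sum_i \sum_j M i j *: phi (delta_mx i j)) :> (_ -> _).
  apply/funext => M; rewrite [in LHS](matrix_sum_delta M) linear_sum.
  apply: eq_bigr => i _; rewrite linear_sum; apply: eq_bigr => j _.
  by rewrite linearZ.
apply: (continuous_big (@add_continuous V)) => i _.
apply: (continuous_big (@add_continuous V)) => j _ M.
by apply: (@cvgZr_tmp _ _ _ (nbhs M)); exact: coord_continuous.
Qed.

End Continuity.

Lemma dotv_grad (R : realType) (n : nat) (g : 'cV[R]_n -> R) z v :
  differentiable g z -> dotv (grad g z) v = 'D_v g z.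
Proof.
move=> g_diff; rewrite deriveE// {2}(matrix_sum_delta v) linear_sum.
apply: eq_bigr => i _; rewrite big_ord1 linearZ mxE deriveE//= mulrC.
by congr (_ * _).
Qed.

Section DirectionalDerivative.
Variable R : realType.
Implicit Type V : normedModType R.

Lemma cvg_derive_at_right V (W : normedModType R) (g : V -> W) x v :
  derivable g x v ->
  h^-1 *: (g (h *: v + x) - g x) @[h --> 0^'+] --> 'D_v g x.
Proof. by move=> g_derivable; exact: cvg_dnbhs_at_right g_derivable. Qed.

Lemma is_derive_quadratic V (q : V -> R) (x v : V) (c K : R) :
  (forall h, q (h *: v + x) = q x + h * c + h ^+ 2 * K) -> is_derive x v q c.
Proof.
move=> qE.
have cvg_quotient : h^-1 *: (q (h *: v + x) - q x) @[h --> 0^'] --> c.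
  have cvg_affine : c + h * K @[h --> 0^'] --> c + 0 * K.
    apply: cvg_within_filter.
    exact: (cvgD (cvg_cst c) (cvgMr_tmp (b := K) cvg_id)).
  rewrite mul0r addr0 in cvg_affine; apply: cvg_trans cvg_affine.
  apply: near_eq_cvg; near=> h.
  have h_neq0 : h != 0 by near: h; exact: nbhs_dnbhs_neq.
  by rewrite qE /GRing.scale /=; field.
by apply: DeriveDef; [exact: cvgP cvg_quotient|exact: cvg_lim cvg_quotient].
Unshelve. all: by end_near. Qed.

End DirectionalDerivative.

Section Convexity.
Variables (R : realType) (V : normedModType R).
Implicit Types (g : V -> R) (Z : set V) (x y z : V).

Lemma conv_lmodE (W : lmodType R) (x y : W) (t : R)
    (t_ge0 : 0 <= t) (t_le1 : t <= 1) :
  conv (Itv01 t_ge0 t_le1) (y : convex_lmodType W) x = t *: (y - x) + x.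
Proof.
transitivity (t *: y + (1 - t) *: x); first by [].
by rewrite scalerBl scale1r scalerBr -addrA [- _ + x]addrC.
Qed.

Lemma convex_derive_le g x y :
  convex_function [set: V] g -> derivable g x (y - x) ->
  'D_(y - x) g x <= g y - g x.
Proof.
move=> g_convex /cvg_derive_at_right cvg_quotient.
apply: (ler_cvg_to cvg_quotient (cvg_cst _)); near=> h.
have h_gt0 : 0 < h by [].
have h_le1 : h <= 1 by near: h; exact: nbhs_right_le.
have := g_convex (Itv01 (ltW h_gt0) h_le1) y x (in_setT _) (in_setT _).
rewrite conv_lmodE convR_line_path /line_path /= => ?.
by rewrite -ler_pdivlMl ?invr_gt0// invrK; lra.
Unshelve. all: by end_near. Qed.

Lemma argmin_derive_ge0 Z g x y :
  convex_set Z -> Z x -> Z y -> (forall z, Z z -> g x <= g z) ->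
  derivable g x (y - x) -> 0 <= 'D_(y - x) g x.
Proof.
move=> Z_convex Zx Zy x_min /cvg_derive_at_right cvg_quotient.
apply: (ler_cvg_to (cvg_cst _) cvg_quotient); near=> h.
have h_gt0 : 0 < h by [].
have h_le1 : h <= 1 by near: h; exact: nbhs_right_le.
rewrite mulr_ge0 ?invr_ge0 ?(ltW h_gt0)// subr_ge0 x_min//.
have := Z_convex y x (Itv01 (ltW h_gt0) h_le1) (mem_set Zy) (mem_set Zx).
by rewrite conv_lmodE => /set_mem.
Unshelve. all: by end_near. Qed.

End Convexity.

Section MinOver.
Variables (R : realType) (n : nat).
Implicit Types (g : 'cV[R]_n -> R) (Z : set 'cV[R]_n) (z : 'cV[R]_n).

Lemma le_min_over Z g (c : R) : Z !=set0 -> (forall z, Z z -> c <= g z) ->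
  c <= min_over Z g.
Proof.
move=> [z Zz] c_le; apply: lb_le_inf; first by exists (g z), z.
by move=> _ [y Zy <-]; exact: c_le.
Qed.

Lemma min_over_attained Z g :
  Z !=set0 -> compact Z -> {within Z, continuous g} ->
  exists z, [/\ Z z, min_over Z g = g z & forall y, Z y -> g z <= g y].
Proof.
move=> Z_nonempty Z_compact /(compact_EVT_min Z_nonempty Z_compact).
move=> [z /set_mem Zz z_min].
have {}z_min y : Z y -> g z <= g y by move=> /mem_set; exact: z_min.
exists z; split=> //; apply/eqP; rewrite eq_le le_min_over// andbT.
by apply: ge_inf; [exists (g z) => _ [y Zy <-]; exact: z_min|exists z].
Qed.

Lemma min_over_le Z g z :
  compact Z -> {within Z, continuous g} -> Z z -> min_over Z g <= g z.
Proof.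
move=> Z_compact g_cont Zz.
have [|y [_ -> y_min]] := min_over_attained _ Z_compact g_cont.
  by exists z.
exact: y_min.
Qed.

Lemma min_over_dotv_le Z (c x z : 'cV[R]_n) : compact Z -> Z z ->
  min_over Z (fun y => dotv c (y - x)) <= dotv c (z - x).
Proof.
move=> Z_compact; apply: (@min_over_le Z (fun y => dotv c (y - x))) => //.
apply: continuous_subspaceT; apply: (@continuous_dotv _ _ _ (cst c)) => y.
  exact: cst_continuous.
by apply: continuousB; [exact: cvg_id|exact: cst_continuous].
Qed.

End MinOver.

Section StepSizes.
Variable R : realType.

Lemma theta_gt0 k : 0 < theta R k.
Proof.
case: k => [|k] /=; first exact: ltr01.
by rewrite divr_gt0// ltr_wpDr// sqrtr_ge0.
Qed.

Lemma sqr_thetaS k : theta R k.+1 ^+ 2 = theta R k ^+ 2 + theta R k.+1.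
Proof.
have : Num.sqrt (4 * theta R k ^+ 2 + 1) ^+ 2 = 4 * theta R k ^+ 2 + 1.
  by rewrite sqr_sqrtr// addr_ge0// mulr_ge0// sqr_ge0.
by rewrite /=; move: (Num.sqrt _) => s; lra.
Qed.

Lemma thetaS_bounds k :
  theta R k + 1 / 2 <= theta R k.+1 <= theta R k + 1.
Proof.
have theta_gt0 := theta_gt0 k.
have sqrt_ge : 2 * theta R k <= Num.sqrt (4 * theta R k ^+ 2 + 1).
  by rewrite -ler_sqr ?nnegrE ?sqrtr_ge0 ?sqr_sqrtr; nra.
have sqrt_le : Num.sqrt (4 * theta R k ^+ 2 + 1) <= 2 * theta R k + 1.
  by rewrite -ler_sqr ?nnegrE ?sqrtr_ge0 ?sqr_sqrtr; nra.
by rewrite /=; lra.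
Qed.

Lemma theta_ge k : (k%:R + 2) / 2 <= theta R k.
Proof.
elim: k => [|k IHk]; first by rewrite /= add0r divff.
by have /andP[+ _] := thetaS_bounds k; rewrite -(natr1 k); lra.
Qed.

Lemma theta_le k : theta R k <= k%:R + 1.
Proof.
elim: k => [|k IHk]; first by rewrite /= add0r.
by have /andP[_] := thetaS_bounds k; rewrite -(natr1 k); lra.
Qed.

Lemma SsumS k : Ssum R k.+1 = Ssum R k + theta R k.+1.
Proof. by rewrite /Ssum big_ord_recr. Qed.

Lemma Ssum_sqr_theta k : Ssum R k = theta R k ^+ 2.
Proof.
elim: k => [|k IHk]; first by rewrite /Ssum big_ord1 /= expr1n.
by rewrite SsumS IHk sqr_thetaS.
Qed.

Lemma Ssum_gt0 k : 0 < Ssum R k.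
Proof. by rewrite Ssum_sqr_theta exprn_gt0// theta_gt0. Qed.

Lemma Ssum_ge k : (k%:R + 1) * (k%:R + 2) / 4 <= Ssum R k.
Proof.
rewrite Ssum_sqr_theta; have := theta_ge k; have := ler0n R k.
by move=> ? ?; nra.
Qed.

Lemma Ssum_le k : Ssum R k <= (k%:R + 1) * (k%:R + 2) / 2.
Proof.
elim: k => [|k IHk]; first by rewrite /Ssum big_ord1 /=; lra.
by rewrite SsumS; have := theta_le k.+1; rewrite -(natr1 k) => ?; lra.
Qed.

Lemma sum_Ssum_le k :
  \sum_(j < k.+1) Ssum R j <= (k%:R + 1) * (k%:R + 2) * (k%:R + 3) / 6.
Proof.
elim: k => [|k IHk]; first by rewrite big_ord1; have := Ssum_le 0; lra.
rewrite big_ord_recr /=; have := Ssum_le k.+1; rewrite -(natr1 k) => ?.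
by lra.
Qed.

Lemma sum_Ssum_ge0 k : 0 <= \sum_(j < k.+1) Ssum R j.
Proof. by apply: sumr_ge0 => j _; exact/ltW/Ssum_gt0. Qed.

Lemma invr_Ssum_le k : (Ssum R k)^-1 <= 4 / ((k%:R + 1) * (k%:R + 2)).
Proof.
have p_gt0 : 0 < (k%:R + 1) * (k%:R + 2) :> R by rewrite mulr_gt0// ltr_wpDl.
rewrite -[leRHS]invrK invf_div lef_pV2 ?posrE ?Ssum_gt0 ?divr_gt0//.
exact: Ssum_ge.
Qed.

Lemma sum_Ssum_div_sqr_le k :
  (\sum_(j < k.+1) Ssum R j) / Ssum R k ^+ 2
  <= 8 * (k%:R + 3) / (3 * (k%:R + 1) * (k%:R + 2)).
Proof.
have S_gt0 := Ssum_gt0 k.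
have p_gt0 : 0 < (k%:R + 1) * (k%:R + 2) :> R by rewrite mulr_gt0// ltr_wpDl.
have /(ler_pM (sum_Ssum_ge0 k) _ (sum_Ssum_le k)) :
    (Ssum R k)^-1 ^+ 2 <= (4 / ((k%:R + 1) * (k%:R + 2))) ^+ 2.
  by rewrite ler_sqr ?nnegrE ?invr_Ssum_le ?invr_ge0 ?divr_ge0// ltW.
rewrite exprVn => /(_ _)/le_trans; apply; first by rewrite invr_ge0 sqr_ge0.
by rewrite le_eqVlt; apply/predU1P; left; field; rewrite !gt_eqF ?ltr_wpDl.
Qed.

Lemma feas_bound_ge (L r delta : R) k : 0 < L -> 0 <= r -> 0 <= delta ->
  L / Ssum R k
    * (2 * r + Num.sqrt (2 / L * (delta * \sum_(j < k.+1) Ssum R j)))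
  <= feas_bound L r delta k.
Proof.
move=> L_gt0 r_ge0 delta_ge0; rewrite /feas_bound mulrDr lerD//.
  have /(ler_wpM2l (mulr_ge0 (ltW L_gt0) r_ge0)) := invr_Ssum_le k.
  lra.
have mulr_sqrt (c x : R) : 0 <= c -> c * Num.sqrt x = Num.sqrt (c ^+ 2 * x).
  by move=> c_ge0; rewrite sqrtrM ?sqr_ge0// sqrtr_sqr ger0_norm.
rewrite !mulr_sqrt ?divr_ge0 ?(ltW L_gt0) ?(ltW (Ssum_gt0 k))//.
apply: ler_wsqrtr.
have Ldelta_ge0 : 0 <= 2 * L * delta by rewrite !mulr_ge0// ltW.
have /(ler_wpM2l Ldelta_ge0) := sum_Ssum_div_sqr_le k.
have -> : (L / Ssum R k) ^+ 2 * (2 / L * (delta * \sum_(j < k.+1) Ssum R j))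
    = 2 * L * delta * ((\sum_(j < k.+1) Ssum R j) / Ssum R k ^+ 2).
  by field; rewrite !gt_eqF ?Ssum_gt0.
move=> /le_trans; apply.
have : 0 <= 2 * L * delta * ((k%:R + 3) / (3 * (k%:R + 1) * (k%:R + 2))).
  by rewrite mulr_ge0// divr_ge0// !mulr_ge0// addr_ge0.
by lra.
Qed.

End StepSizes.

Arguments theta R k : simpl never.

Definition oracle_model (R : realType) (m : nat) (val : 'cV[R]_m -> R)
    (g : 'cV[R]_m -> 'cV[R]_m) (y l : 'cV[R]_m) : R :=
  val y + dotv (g y) (l - y).

(* The (delta, L)-oracles of Devolder, Glineur and Nesterov, for a concave
   function [D] to be maximized; neither [val] nor [g] need be exact. *)
Definition inexact_oracle (R : realType) (m : nat) (L delta : R)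
    (D val : 'cV[R]_m -> R) (g : 'cV[R]_m -> 'cV[R]_m) : Prop :=
  forall y l,
    0 <= oracle_model val g y l - D l <= L / 2 * enorm (l - y) ^+ 2 + delta.

Section InexactOracle.
Variables (R : realType) (m : nat) (L delta : R).
Variables (D val : 'cV[R]_m -> R) (g : 'cV[R]_m -> 'cV[R]_m).
Hypothesis L_gt0 : 0 < L.
Hypothesis oracle : inexact_oracle L delta D val g.
Local Notation model := (oracle_model val g).

Let L_neq0 : L != 0. Proof. by rewrite gt_eqF. Qed.

Lemma inexact_oracle_delta_ge0 : 0 <= delta.
Proof.
have := oracle 0 0; rewrite sqr_enorm subrr !linear0r add0r => /andP[].
exact: le_trans.
Qed.

Lemma oracle_model_ge y l : D l <= model y l.
Proof. by have /andP[] := oracle y l; rewrite subr_ge0. Qed.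

Lemma oracle_ascent y :
  val y + dotv (g y) (g y) / (2 * L) <= D (y + L^-1 *: g y) + delta.
Proof.
have /andP[_] := oracle y (y + L^-1 *: g y).
rewrite /oracle_model sqr_enorm (addrC y) addrK !dotv_linear /=.
have -> : L / 2 * (L^-1 * (L^-1 * dotv (g y) (g y)))
    = dotv (g y) (g y) / (2 * L) by field.
have -> : L^-1 * dotv (g y) (g y) = 2 * (dotv (g y) (g y) / (2 * L)) by field.
by lra.
Qed.

Section FastGradient.
Variables lambda mu : nat -> 'cV[R]_m.

Definition prox_center k :=
  lambda 0%N + L^-1 *: \sum_(j < k.+1) theta R j *: g (lambda j).

Definition estimate k l :=
  \sum_(j < k.+1) theta R j * model (lambda j) l
  - L / 2 * enorm (l - lambda 0%N) ^+ 2.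

Hypothesis muE : forall k, mu k = lambda k + L^-1 *: g (lambda k).
Hypothesis lambdaE : forall k, lambda k.+1 =
  (1 - acoef R k.+1) *: mu k + acoef R k.+1 *: prox_center k.

Lemma estimateS k l :
  estimate k.+1 l = estimate k l + theta R k.+1 * model (lambda k.+1) l.
Proof. by rewrite /estimate big_ord_recr addrAC. Qed.

Lemma prox_centerS k :
  prox_center k.+1 = prox_center k + (theta R k.+1 / L) *: g (lambda k.+1).
Proof. by rewrite /prox_center big_ord_recr scalerDr addrA scalerA mulrC. Qed.

Lemma estimate_prox_center k l : estimate k l
  = estimate k (prox_center k) - L / 2 * enorm (l - prox_center k) ^+ 2.
Proof.
set c := prox_center k; set G := \sum_(j < k.+1) theta R j *: g (lambda j).
have model_sum : \sum_(j < k.+1) theta R j * model (lambda j) l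
    = \sum_(j < k.+1) theta R j * model (lambda j) c + dotv G (l - c).
  rewrite linear_sumlz -big_split; apply: eq_bigr => j _ /=.
  by rewrite /oracle_model !dotv_linear /=; lra.
have GE : G = L *: (c - lambda 0%N).
  by rewrite /c /prox_center addrC addKr scalerA mulfV// scale1r.
rewrite /estimate model_sum GE !sqr_enorm.
have -> : l - lambda 0%N = (l - c) + (c - lambda 0%N) by rewrite addrA subrK.
move: (l - c) (c - _) => u v; rewrite !dotv_linear /= (dotvC v u).
by field.
Qed.

Lemma momentum_balance k :
  Ssum R k *: (mu k - lambda k.+1)
  + theta R k.+1 *: (prox_center k - lambda k.+1) = 0.
Proof.
have := Ssum_gt0 R k.+1; rewrite lambdaE /acoef SsumS => S_gt0.
move: (prox_center k) => c; apply/colP => i; rewrite !mxE.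
by field; rewrite gt_eqF.
Qed.

Lemma estimate_prox_centerS k :
  estimate k.+1 (prox_center k.+1) = estimate k (prox_center k)
    + theta R k.+1 * model (lambda k.+1) (prox_center k)
    + Ssum R k.+1 * (dotv (g (lambda k.+1)) (g (lambda k.+1)) / (2 * L)).
Proof.
rewrite estimateS estimate_prox_center prox_centerS Ssum_sqr_theta sqr_enorm.
set c := prox_center k; set l := lambda k.+1.
rewrite /oracle_model [_ - c]addrAC subrr add0r [_ - l]addrAC !dotv_linear /=.
by field.
Qed.

Lemma estimate_le k : estimate k (prox_center k)
  <= Ssum R k * D (mu k) + delta * \sum_(j < k.+1) Ssum R j.
Proof.
elim: k => [|k IHk].
  have := oracle_ascent (lambda 0%N); rewrite -muE.
  rewrite /estimate /prox_center /oracle_model /Ssum !big_ord1.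
  rewrite (_ : theta R 0 = 1)// !mul1r scale1r mulr1 (addrC (lambda 0%N)) addrK.
  rewrite sqr_enorm !dotv_linear /=; apply: le_trans.
  by rewrite le_eqVlt; apply/predU1P; left; field.
rewrite estimate_prox_centerS big_ord_recr /=; set l := lambda k.+1.
have balance : Ssum R k * dotv (g l) (mu k - l)
    + theta R k.+1 * dotv (g l) (prox_center k - l) = 0.
  have := congr1 (dotv (g l)) (momentum_balance k).
  by rewrite linear0r !dotv_linear.
have model_ge : Ssum R k * D (mu k) <= Ssum R k * model l (mu k).
  by rewrite ler_pM2l ?Ssum_gt0 ?oracle_model_ge.
have ascent : Ssum R k.+1 * (val l + dotv (g l) (g l) / (2 * L))
    <= Ssum R k.+1 * (D (mu k.+1) + delta).
  by rewrite ler_pM2l ?Ssum_gt0// muE oracle_ascent.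
by move: ascent model_ge; rewrite /oracle_model SsumS; lra.
Qed.

Lemma prox_center_dist ls k : (forall l, D l <= D ls) ->
  enorm (prox_center k - ls) ^+ 2 <= enorm (lambda 0%N - ls) ^+ 2
    + 2 / L * (delta * \sum_(j < k.+1) Ssum R j).
Proof.
move=> ls_max.
have estimate_ge : Ssum R k * D ls - L / 2 * enorm (lambda 0%N - ls) ^+ 2
    <= estimate k ls.
  rewrite /estimate enorm_distC lerD2r /Ssum mulr_suml.
  apply: ler_sum => j _; rewrite ler_pM2l ?theta_gt0//.
  exact: oracle_model_ge.
have D_le : Ssum R k * D (mu k) <= Ssum R k * D ls.
  by rewrite ler_pM2l ?Ssum_gt0.
rewrite -(ler_pM2l (divr_gt0 L_gt0 (ltr0Sn R 1))) mulrDr.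
have -> x : L / 2 * (2 / L * x) = x by field.
have := estimate_le k; move: estimate_ge.
by rewrite estimate_prox_center (enorm_distC ls (prox_center k)); lra.
Qed.

Lemma prox_center_displacement ls k : (forall l, D l <= D ls) ->
  enorm (prox_center k - lambda 0%N) <= 2 * enorm (lambda 0%N - ls)
    + Num.sqrt (2 / L * (delta * \sum_(j < k.+1) Ssum R j)).
Proof.
move=> /(prox_center_dist k).
set E := 2 / L * _; set r := enorm (lambda 0%N - ls) => dist_le.
have E_ge0 : 0 <= E.
  rewrite mulr_ge0 ?divr_ge0 ?(ltW L_gt0)//.
  by rewrite mulr_ge0 ?inexact_oracle_delta_ge0 ?sum_Ssum_ge0.
have center_le : enorm (prox_center k - ls) <= r + Num.sqrt E.
  rewrite -ler_sqr ?nnegrE ?addr_ge0 ?enorm_ge0 ?sqrtr_ge0// sqrrD.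
  have : 0 <= r * Num.sqrt E by rewrite mulr_ge0 ?enorm_ge0 ?sqrtr_ge0.
  by rewrite (sqr_sqrtr E_ge0); lra.
have := ler_enormD (prox_center k - ls) (ls - lambda 0%N).
by rewrite addrA subrK (enorm_distC ls) -/r; lra.
Qed.

Lemma enorm_mean_gradient_le ls k : (forall l, D l <= D ls) ->
  enorm ((Ssum R k)^-1 *: \sum_(j < k.+1) theta R j *: g (lambda j))
  <= feas_bound L (enorm (lambda 0%N - ls)) delta k.
Proof.
move=> ls_max; have S_gt0 := Ssum_gt0 R k.
apply: le_trans (feas_bound_ge k L_gt0 (enorm_ge0 _) inexact_oracle_delta_ge0).
have -> : (Ssum R k)^-1 *: \sum_(j < k.+1) theta R j *: g (lambda j)
    = (L / Ssum R k) *: (prox_center k - lambda 0%N).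
  rewrite /prox_center (addrC (lambda 0%N)) addrK scalerA mulrAC mulfV//.
  by rewrite mul1r.
rewrite enormZ gtr0_norm ?divr_gt0// ler_pM2l ?divr_gt0//.
exact: prox_center_displacement.
Qed.

End FastGradient.
End InexactOracle.

Definition residual (R : realType) (m n : nat) (A : 'M[R]_(m, n))
    (b : 'cV[R]_m) (z : 'cV[R]_n) : 'cV[R]_m :=
  A *m z - b.

Definition aug_dual (R : realType) (m n : nat) (f : 'cV[R]_n -> R)
    (A : 'M[R]_(m, n)) (b : 'cV[R]_m) (Z : set 'cV[R]_n) (rho : R)
    (l : 'cV[R]_m) : R :=
  min_over Z (aug_lagr f A b rho l).

Section Residual.
Variables (R : realType) (m n : nat) (A : 'M[R]_(m, n)) (b : 'cV[R]_m).

Lemma residualB y z : residual A b y - residual A b z = A *m (y - z).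
Proof. by rewrite mulmxBr opprB addrA subrK. Qed.

Lemma residualD z v : residual A b (v + z) = A *m v + residual A b z.
Proof. by rewrite /residual mulmxDr addrA. Qed.

Lemma residual_mean (I : finType) (c : I -> R) (z : I -> 'cV[R]_n) :
  \sum_i c i != 0 ->
  residual A b ((\sum_i c i)^-1 *: \sum_i c i *: z i)
  = (\sum_i c i)^-1 *: \sum_i c i *: residual A b (z i).
Proof.
move=> c_neq0; have -> : \sum_i c i *: residual A b (z i)
    = A *m (\sum_i c i *: z i) - (\sum_i c i) *: b.
  rewrite mulmx_sumr scaler_suml -sumrB; apply: eq_bigr => i _.
  by rewrite scalerBr scalemxAr.
by rewrite scalerBr scalerA mulVf// scale1r scalemxAr.
Qed.

Lemma continuous_residual : continuous (residual A b).
Proof.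
have -> : residual A b = mulmx A - cst b by apply/funext.
move=> z; apply: continuousB; last exact: cst_continuous.
exact: (linear_mx_continuous (phi := mulmx A)).
Qed.

End Residual.

Section AugmentedLagrangian.
Variables (R : realType) (m n : nat) (f : 'cV[R]_n -> R) (A : 'M[R]_(m, n)).
Variables (b : 'cV[R]_m) (rho : R).
Local Notation w := (residual A b).
Local Notation AL := (aug_lagr f A b rho).

Lemma aug_lagrE l z :
  AL l z = f z + dotv l (w z) + rho / 2 * dotv (w z) (w z).
Proof. by rewrite /aug_lagr sqr_enorm. Qed.

Lemma aug_lagr_affine l1 l2 z : AL l2 z = AL l1 z + dotv (w z) (l2 - l1).
Proof. by rewrite !aug_lagrE (dotvC (w z)) !dotv_linear /=; lra. Qed.

Lemma continuous_lagr l : continuous f -> continuous (lagr f A b l).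
Proof.
move=> f_cont; have -> : lagr f A b l = f + (fun z => dotv l (w z)).
  by apply/funext.
move=> z; apply: continuousD; first exact: f_cont.
apply: (@continuous_dotv _ _ _ (cst l) w) => x; first exact: cst_continuous.
exact: continuous_residual.
Qed.

Lemma continuous_aug_lagr l : continuous f -> continuous (AL l).
Proof.
move=> f_cont; have -> : AL l =
    lagr f A b l + cst (rho / 2) * (fun z => dotv (w z) (w z)).
  by apply/funext => z; rewrite aug_lagrE.
move=> z; apply: continuousD; first exact: continuous_lagr.
apply: continuousM; first exact: cst_continuous.
by apply: continuous_dotv => x; exact: continuous_residual.
Qed.

Lemma is_derive_aug_lagr l z v df : is_derive z v f df ->
  is_derive z v (AL l) (df + dotv (l + rho *: w z) (A *m v)).
Proof.
move=> f_derive; have -> : AL l =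
    f + (fun y => dotv l (w y) + rho / 2 * dotv (w y) (w y)).
  by apply/funext => y; rewrite aug_lagrE -addrA.
apply: is_deriveD; apply: (@is_derive_quadratic _ _ _ _ _ _
  (rho / 2 * dotv (A *m v) (A *m v))) => h.
rewrite residualD -scalemxAr; move: (w z) (A *m v) => u p.
by rewrite !dotv_linear /= (dotvC p u); lra.
Qed.

Lemma grad_aug_lagr l z : differentiable f z ->
  grad (AL l) z = grad f z + A^T *m (l + rho *: w z).
Proof.
move=> f_diff; apply/colP => i; rewrite [LHS]mxE [RHS]mxE [X in X + _]mxE.
have := diff_derivable (v := delta_mx i ord0) f_diff.
move=> /derivableP/(is_derive_aug_lagr l)/@derive_val ->.
by rewrite dotv_mulmx dotv_delta.
Qed.

Lemma dotv_grad_aug_lagr l z v : differentiable f z ->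
  dotv (grad (AL l) z) v = 'D_v (AL l) z.
Proof.
move=> f_diff; have := diff_derivable (v := v) f_diff.
move=> /derivableP/(is_derive_aug_lagr l)/@derive_val ->.
by rewrite grad_aug_lagr// linearDl /= dotv_grad// -dotv_mulmx.
Qed.

Lemma derive_aug_lagr_le l z y :
  convex_function [set: 'cV[R]_n] f -> derivable f z (y - z) ->
  'D_(y - z) (AL l) z <= f y - f z + dotv (l + rho *: w z) (w y - w z).
Proof.
move=> f_convex f_derivable; have := derivableP f_derivable.
move=> /(is_derive_aug_lagr l)/@derive_val ->.
by rewrite residualB lerD2r convex_derive_le.
Qed.

End AugmentedLagrangian.

Section AugmentedDual.
Variables (R : realType) (m n : nat) (f : 'cV[R]_n -> R) (A : 'M[R]_(m, n)).
Variables (b : 'cV[R]_m) (Z : set 'cV[R]_n) (rho : R).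
Hypothesis f_convex : convex_function [set: 'cV[R]_n] f.
Hypothesis f_diff : forall z, differentiable f z.
Hypothesis Z_nonempty : Z !=set0.
Hypothesis Z_compact : compact Z.
Hypothesis rho_gt0 : 0 < rho.
Local Notation w := (residual A b).
Local Notation AL := (aug_lagr f A b rho).
Local Notation D := (aug_dual f A b Z rho).

Let f_cont : continuous f.
Proof. by move=> z; exact: differentiable_continuous. Qed.

Lemma aug_dual_le l z : Z z -> D l <= AL l z.
Proof.
apply: min_over_le => //; apply: continuous_subspaceT.
exact: continuous_aug_lagr.
Qed.

(* Completing the square in [w y - w z] makes the smoothness constant of the
   augmented dual exactly [rho^-1], whatever the curvature of [f]. *)
Lemma approx_stationary_aug_lagr_le l0 l z y delta :
  - delta <= dotv (grad (AL l0) z) (y - z) ->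
  AL l z <= AL l y + rho^-1 / 2 * enorm (l - l0) ^+ 2 + delta.
Proof.
have f_derivable := diff_derivable (v := y - z) (f_diff z).
rewrite dotv_grad_aug_lagr//.
move=> /le_trans/(_ (derive_aug_lagr_le A b rho l0 f_convex f_derivable)).
have := mulr_ge0 (ltW rho_gt0) (dotv_ge0 (w y - w z + rho^-1 *: (l - l0))).
rewrite sqr_enorm 2!(aug_lagr_affine f A b rho l0 l) !aug_lagrE.
move: (w y) (w z) (l - l0) => p q d.
rewrite !dotv_linear /= (dotvC p d) (dotvC q d) (dotvC q p).
have mulVrho x : rho * (rho^-1 * x) = x by rewrite mulVKf// gt_eqF.
by rewrite !mulrDr !mulrN !mulVrho; lra.
Qed.

Lemma aug_dual_inexact_oracle (zbar : 'cV[R]_m -> 'cV[R]_n) delta :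
  (forall l, Z (zbar l)) ->
  (forall l, - delta
     <= min_over Z (fun z => dotv (grad (AL l) (zbar l)) (z - zbar l))) ->
  inexact_oracle rho^-1 delta D (fun l => AL l (zbar l)) (fun l => w (zbar l)).
Proof.
move=> zbarZ zbar_approx l0 l.
rewrite /oracle_model -aug_lagr_affine subr_ge0 aug_dual_le//=.
rewrite lerBlDr -lerBlDl; apply: le_min_over => // z Zz.
have := le_trans (zbar_approx l0) (min_over_dotv_le _ _ Z_compact Zz).
by move=> /(approx_stationary_aug_lagr_le l); lra.
Qed.

Hypothesis Z_convex : convex_set Z.

(* An exact minimizer [z] of the augmented Lagrangian at [l] also minimizes the
   ordinary Lagrangian at the shifted multiplier [l + rho (A z - b)]. *)
Lemma aug_dual_le_dual l : exists l', D l <= dual f A b Z l'.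
Proof.
have [|z [Zz Dl z_min]] :=
    min_over_attained (g := AL l) Z_nonempty Z_compact.
  by apply: continuous_subspaceT; exact: continuous_aug_lagr.
exists (l + rho *: w z); rewrite /aug_dual Dl; apply: le_min_over => // y Zy.
have f_derivable := diff_derivable (v := y - z) (f_diff z).
have aug_derivable : derivable (AL l) z (y - z).
  by have /derivableP/(is_derive_aug_lagr A b rho l)/@ex_derive := f_derivable.
have := argmin_derive_ge0 Z_convex Zz Zy z_min aug_derivable.
move=> /le_trans/(_ (derive_aug_lagr_le A b rho l f_convex f_derivable)).
have := mulr_ge0 (ltW rho_gt0) (dotv_ge0 (w z)).
rewrite aug_lagrE /lagr -/(w y); move: (w y) (w z) => p q.
by rewrite !dotv_linear /=; lra.
Qed.

Lemma dual_le_aug_dual l : dual f A b Z l <= D l.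
Proof.
apply: le_min_over => // z Zz; apply: (@le_trans _ _ (lagr f A b l z)).
  apply: min_over_le => //; apply: continuous_subspaceT.
  exact: continuous_lagr.
by rewrite aug_lagrE lerDl mulr_ge0 ?divr_ge0 ?(ltW rho_gt0) ?dotv_ge0.
Qed.

Lemma dual_solution_aug_dual_max ls : dual_solution f A b Z ls ->
  forall l, D l <= D ls.
Proof.
move=> ls_max l; have [l' /le_trans] := aug_dual_le_dual l; apply.
exact: le_trans (ls_max l') (dual_le_aug_dual ls).
Qed.

End AugmentedDual.

Theorem theorem3p7 (R : realType) (m n : nat)
  (f : 'cV[R]_n -> R) (A : 'M[R]_(m, n)) (b : 'cV[R]_m) (Z : set 'cV[R]_n)
  (rho eps_in Lp : R)
  (f_convex : convex_function [set: 'cV[R]_n] f)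
  (f_diff : forall z, differentiable f z)
  (A_full : \rank A = m)
  (Z_nonempty : Z !=set0) (Z_compact : compact Z) (Z_convex : convex_set Z)
  (rho_gt0 : 0 < rho) (eps_in_gt0 : 0 < eps_in) (Lp_gt0 : 0 < Lp)
  (grad_lipschitz : forall (l : 'cV[R]_m) (z y : 'cV[R]_n),
     enorm (grad (aug_lagr f A b rho l) z - grad (aug_lagr f A b rho l) y)
       <= Lp * enorm (z - y))
  (slater_cq : slater A b Z)
  (lambda_star : 'cV[R]_m) (lambda_starP : dual_solution f A b Z lambda_star)
  (Rp := diameter Z) (Ld := 1 / rho)
  (zbar : 'cV[R]_m -> 'cV[R]_n)
  (zbar_in : forall l, Z (zbar l))
  (zbar_approx : forall l,
     min_over Z (fun z => dotv (grad (aug_lagr f A b rho l) (zbar l))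
                               (z - zbar l))
       >= - ((1 + Num.sqrt (2 * Lp) * Rp) * eps_in))
  (graddbar := fun l : 'cV[R]_m => A *m zbar l - b)
  (lambda mu : nat -> 'cV[R]_m)
  (muE : forall k, mu k = lambda k + Ld^-1 *: graddbar (lambda k))
  (lambdaE : forall k, lambda k.+1 =
     (1 - acoef R k.+1) *: mu k +
     acoef R k.+1 *: (lambda 0%N + Ld^-1 *:
       \sum_(i < k.+1) theta R i *: graddbar (lambda i)))
  (Rd := enorm (lambda 0%N - lambda_star))
  (zhat := fun k : nat =>
     (Ssum R k)^-1 *: \sum_(j < k.+1) theta R j *: zbar (lambda j)) :
  forall k : nat,
    enorm (A *m zhat k - b) <=
      feas_bound Ld Rd ((1 + Num.sqrt (2 * Lp) * Rp) * eps_in) k.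
Proof.
move=> k; set delta := _ * eps_in.
have LdE : Ld = rho^-1 by rewrite /Ld div1r.
have oracle : inexact_oracle Ld delta (aug_dual f A b Z rho)
    (fun l => aug_lagr f A b rho l (zbar l)) graddbar.
  by rewrite LdE; exact: aug_dual_inexact_oracle.
have lambda_star_max := dual_solution_aug_dual_max f_convex f_diff Z_nonempty
  Z_compact rho_gt0 Z_convex lambda_starP.
rewrite -[A *m _ - b]/(residual A b (zhat k)) residual_mean; last first.
  by rewrite gt_eqF ?Ssum_gt0.
apply: (enorm_mean_gradient_le _ oracle muE lambdaE) => //.
by rewrite LdE invr_gt0.
Qed.
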